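(* Let $d \ge 1$ and $\tau_{\max} \ge 0$ be integers. For each $i \in \{0,1,\dots,\tau_{\max}\}$ let $g_i$ be an estimator taking as input a binary vector $\mathbf{x} \in \{0,1\}^d$ and returning a real number $g_i(\mathbf{x})$, and define, for $\tau \in \{0,1,\dots,\tau_{\max}\}$, $$g(\mathbf{x},\tau) = \sum_{i=0}^{\tau} g_i(\mathbf{x}).$$ If each $g_i(\mathbf{x})$ is deterministic and non-negative, then $g(\mathbf{x},\tau)$ is monotonically increasing with $\tau$: for every $\mathbf{x} \in \{0,1\}^d$ and all $\tau_1 \le \tau_2$ in $\{0,1,\dots,\tau_{\max}\}$, $g(\mathbf{x},\tau_1) \le g(\mathbf{x},\tau_2)$.
   Context: ''Deterministic'' means that the output $g_i(\mathbf{x})$ is determined by the input $\mathbf{x}$ (and the index $i$), i.e. $g_i$ is an ordinary function $\{0,1\}^d \to \mathbb{R}$ with no randomness; ''non-negative'' means $g_i(\mathbf{x}) \ge 0$ for all $\mathbf{x} \in \{0,1\}^d$. ''Monotonically increasing'' is meant in the non-strict sense (a larger input gives a larger or equal output). *)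

(* Defs.v *)
From mathcomp Require Import all_boot all_order all_algebra.
From mathcomp Require Import reals.

Set Implicit Arguments.
Unset Strict Implicit.
Unset Printing Implicit Defensive.

Import Order.TTheory GRing.Theory Num.Theory.

Local Open Scope ring_scope.

Definition estimator (R : realType) (d : nat) := d.-tuple bool -> R.

(* The indices i and tau range over {0, ..., tau_max} = 'I_tau_max.+1, so the
   sum over 0 <= i <= tau is the sum over that type restricted to i <= tau. *)
Definition cumul_estimator (R : realType) (d tau_max : nat)
    (g_ : 'I_tau_max.+1 -> estimator R d)
    (x : d.-tuple bool) (tau : 'I_tau_max.+1) : R :=
  \sum_(i < tau_max.+1 | (i <= tau)%N) g_ i x.

(* Main.v *)
Require Import Defs.
From mathcomp Require Import all_boot all_order all_algebra.
From mathcomp Require Import reals.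

Set Implicit Arguments.
Unset Strict Implicit.
Unset Printing Implicit Defensive.

Import Order.TTheory GRing.Theory Num.Theory.

Local Open Scope ring_scope.

Theorem lemma2 (R : realType) (d tau_max : nat) (d_ge1 : (1 <= d)%N)
    (g_ : 'I_tau_max.+1 -> estimator R d)
    (g_ge0 : forall (i : 'I_tau_max.+1) (x : d.-tuple bool), 0 <= g_ i x) :
  forall (x : d.-tuple bool) (tau1 tau2 : 'I_tau_max.+1),
    (tau1 <= tau2)%N ->
    cumul_estimator g_ x tau1 <= cumul_estimator g_ x tau2.
Proof.
(* Moving the bound on [i] into the summand, with default 0, puts both sums over the same full
   range, so they compare term by term. Giving the predicate keeps [!] from rewriting the resulting
   unconditional sums again. *)
move=> x tau1 tau2 le_tau; rewrite /cumul_estimator !(big_mkcond (fun i : 'I__ => i <= _)%N) /=.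
apply: ler_sum => i _; case: (leqP i tau1) => [le_i | _].
  by rewrite (leq_trans le_i le_tau).
(* For [i > tau1] the left term is 0, and the right one is [g_ i x] or 0: this is where [g_ge0]
   enters. *)
by case: ifP.
Qed.
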